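(* Given a weighted temporal graph $G=(V,E)$ and $s,z\in V$, the following decision problems can be solved in polynomial time: (1) given an $(s,z)$-path $P$, decide whether $P$ is efficient with respect to arrival time and cost; (2) given $c\in\mathbb{R}_{\ge0}$ and $a\in\mathbb{N}$, decide whether there exists an $(s,z)$-path $P$ with $a(P)\le a$ and $c(P)\le c$.
   Context: A weighted temporal graph $G=(V,E)$ has temporal edges $e=(u,v,t,\lambda,c)$ with $u\neq v$, availability time $t\in\mathbb{N}$, traversal time $\lambda\in\mathbb{N}$, cost $c\in\mathbb{R}_{\ge0}$ (zero costs allowed). A temporal $(u,v)$-path is a sequence $(e_1,\ldots,e_k)$, $e_i=(v_i,v_{i+1},t_i,\lambda_i,c_i)\in E$, $v_1=u$, $v_{k+1}=v$, $t_i+\lambda_i\le t_{i+1}$ for $1\le i<k$, visiting each vertex at most once; arrival time $a(P)=t_k+\lambda_k$, cost $c(P)=\sum_i c_i$. An $(s,z)$-path $P$ is efficient w.r.t. arrival time and cost if no $(s,z)$-path $Q$ has ($c(Q)<c(P)$ and $a(Q)\le a(P)$) or ($c(Q)\le c(P)$ and $a(Q)<a(P)$). *)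

(* Defs.v *)
From HB Require Import structures.
From mathcomp Require Import all_boot all_order all_algebra.
From mathcomp Require Import reals.

Set Implicit Arguments.
Unset Strict Implicit.
Unset Printing Implicit Defensive.

Import Order.TTheory GRing.Theory Num.Theory.

Local Open Scope ring_scope.

(** * Weighted temporal graphs *)

Record tedge (V : finType) (R : realType) := TEdge {
  src : V;
  dst : V;
  avail : nat;
  trav : nat;
  cost : R
}.

Section TedgeEq.
Variables (V : finType) (R : realType).

Definition tuple_of_tedge (e : tedge V R) : V * V * nat * nat * R :=
  (src e, dst e, avail e, trav e, cost e).

Definition tedge_of_tuple (x : V * V * nat * nat * R) : tedge V R :=
  let: (u, v, t, l, c) := x in TEdge u v t l c.

Lemma tuple_of_tedgeK : cancel tuple_of_tedge tedge_of_tuple.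
Proof. by case. Qed.

HB.instance Definition _ := Equality.copy (tedge V R) (can_type tuple_of_tedgeK).
End TedgeEq.

(* The edge set is given by a duplicate-free enumeration, in the order in which
   it is presented to an algorithm. Both availability and traversal times may
   be 0, and parallel edges differing in any attribute are allowed. *)
Record tgraph (R : realType) := TGraph {
  vertices : finType;
  edges : seq (tedge vertices R);
  edges_uniq : uniq edges;
  edges_loopless : forall e, e \in edges -> src e != dst e;
  edges_cost_ge0 : forall e, e \in edges -> 0 <= cost e
}.

Section Paths.
Variables (R : realType) (G : tgraph R).
Implicit Types (u v : vertices G) (P : seq (tedge (vertices G) R)).

Definition follows (e f : tedge (vertices G) R) : bool :=
  (dst e == src f) && (avail e + trav e <= avail f)%N.

(* A path has at least one edge (its arrival time is that of its last edge);
   since its vertices are distinct, there is no path from a vertex to itself. *)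
Definition is_path u v P : bool :=
  if P is e :: p then
    [&& all (mem (edges G)) (e :: p),
        path follows e p,
        src e == u,
        dst (last e p) == v
      & uniq (src e :: [seq dst f | f <- e :: p])]
  else false.

Definition arrival P : nat :=
  if P is e :: p then (avail (last e p) + trav (last e p))%N else 0%N.

Definition path_cost P : R := \sum_(e <- P) cost e.

Definition efficient u v P : Prop :=
  is_path u v P /\
  ~ exists2 Q, is_path u v Q &
      (path_cost Q < path_cost P /\ (arrival Q <= arrival P)%N) \/
      (path_cost Q <= path_cost P /\ (arrival Q < arrival P)%N).

End Paths.

(** * Polynomial time over the naturals and the reals *)

(* Inputs contain real numbers, so the machine is a random access machine with
   two sorts of registers and memory cells, one holding naturals and one holding
   reals. Every instruction and every test takes one step. On both sorts the
   only arithmetic operations are addition and subtraction, so that the values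
   computed in polynomially many steps have polynomially many bits (for the
   reals: when the input reals are rational); with unit-cost multiplication
   this would fail. There are no real constants, which could encode unbounded
   advice, and no conversion between the two sorts. Memory is addressed
   indirectly, through registers holding naturals. *)

Inductive instr :=
  | NConst of nat & nat        (* N_x := k *)
  | NAdd of nat & nat & nat    (* N_x := N_y + N_z *)
  | NSub of nat & nat & nat    (* N_x := N_y - N_z, truncated at 0 *)
  | NLoad of nat & nat         (* N_x := NMEM[N_y] *)
  | NStore of nat & nat        (* NMEM[N_x] := N_y *)
  | RAdd of nat & nat & nat    (* R_x := R_y + R_z *)
  | RSub of nat & nat & nat    (* R_x := R_y - R_z *)
  | RLoad of nat & nat         (* R_x := RMEM[N_y] *)
  | RStore of nat & nat.       (* RMEM[N_x] := R_y *)

Inductive test :=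
  | NLe of nat & nat           (* N_x <= N_y *)
  | RLe of nat & nat.          (* R_x <= R_y *)

Inductive cmd :=
  | Do of instr
  | If of test & seq cmd & seq cmd
  | While of test & seq cmd.

Definition program := seq cmd.

Section Machine.
Variable R : realType.

Record state := State {
  nreg : nat -> nat;
  nmem : nat -> nat;
  rreg : nat -> R;
  rmem : nat -> R
}.

Definition exec (i : instr) (st : state) : state :=
  let: State n nm r rm := st in
  match i with
  | NConst x k => State [eta n with x |-> k] nm r rm
  | NAdd x y z => State [eta n with x |-> (n y + n z)%N] nm r rm
  | NSub x y z => State [eta n with x |-> (n y - n z)%N] nm r rm
  | NLoad x y => State [eta n with x |-> nm (n y)] nm r rm
  | NStore x y => State n [eta nm with n x |-> n y] r rm
  | RAdd x y z => State n nm [eta r with x |-> r y + r z] rm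
  | RSub x y z => State n nm [eta r with x |-> r y - r z] rm
  | RLoad x y => State n nm [eta r with x |-> rm (n y)] rm
  | RStore x y => State n nm r [eta rm with n x |-> r y]
  end.

Definition holds (b : test) (st : state) : bool :=
  match b with
  | NLe x y => (nreg st x <= nreg st y)%N
  | RLe x y => rreg st x <= rreg st y
  end.

(* A configuration is the list of the commands that remain to be executed and
   the state; the machine has halted when no command remains. *)
Definition step (cf : program * state) : program * state :=
  let: (p, st) := cf in
  match p with
  | [::] => ([::], st)
  | Do i :: k => (k, exec i st)
  | If b p1 p2 :: k => ((if holds b st then p1 else p2) ++ k, st)
  | While b q :: k => (if holds b st then q ++ While b q :: k else k, st)
  end.

(* The input is a list of naturals and a list of reals, stored in the memory
   cells from address 0 on; everything else is initially 0. *)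
Definition init (w : seq nat * seq R) : state :=
  State (fun=> 0%N) (fun i => nth 0%N w.1 i) (fun=> 0) (fun i => nth 0 w.2 i).

Definition bit_length (n : nat) : nat := (trunc_log 2 n).+1.

(* A natural counts with its binary length, a real counts as one. *)
Definition input_size (w : seq nat * seq R) : nat :=
  (\sum_(n <- w.1) bit_length n + size w.2)%N.

(* [X] is the type of the instances, [code] presents them to the machine, and
   [L] is the set of yes-instances. The answer is read off register N_0. *)
Definition polytime_decidable (X : Type) (code : X -> seq nat * seq R)
    (L : X -> Prop) : Prop :=
  exists (p : program) (c k : nat), forall x : X,
    let cf := iter (c * input_size (code x) ^ k + c)%N step (p, init (code x)) in
    cf.1 = [::] /\ (nreg cf.2 0%N <> 0%N <-> L x).

End Machine.

(** * The two decision problems *)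

Section Problems.
Variable R : realType.

Definition vertex_code (V : finType) (v : V) : nat := enum_rank v.

Definition edges_code (V : finType) (es : seq (tedge V R)) : seq nat :=
  flatten [seq [:: vertex_code (src e); vertex_code (dst e); avail e; trav e]
          | e <- es].

(* The vertices are listed explicitly, so that the size of an input is at least
   the number of vertices plus the number of edges. *)
Definition graph_code (G : tgraph R) : seq nat :=
  #|vertices G| :: [seq vertex_code v | v <- enum (vertices G)] ++
  size (edges G) :: edges_code (edges G).

Record efficiency_instance := EfficiencyInstance {
  eff_graph : tgraph R;
  eff_s : vertices eff_graph;
  eff_z : vertices eff_graph;
  eff_path : seq (tedge (vertices eff_graph) R);
  eff_is_path : is_path eff_s eff_z eff_path
}.

Definition efficiency_code (x : efficiency_instance) : seq nat * seq R :=
  ([:: vertex_code (eff_s x); vertex_code (eff_z x)] ++ graph_code (eff_graph x)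
     ++ size (eff_path x) :: edges_code (eff_path x),
   [seq cost e | e <- edges (eff_graph x)] ++ [seq cost e | e <- eff_path x]).

Record bounded_path_instance := BoundedPathInstance {
  bp_graph : tgraph R;
  bp_s : vertices bp_graph;
  bp_z : vertices bp_graph;
  bp_cost : R;
  bp_cost_ge0 : 0 <= bp_cost;
  bp_arrival : nat
}.

Definition bounded_path_code (x : bounded_path_instance) : seq nat * seq R :=
  ([:: vertex_code (bp_s x); vertex_code (bp_z x); bp_arrival x]
     ++ graph_code (bp_graph x),
   bp_cost x :: [seq cost e | e <- edges (bp_graph x)]).

End Problems.

(* Main.v *)
(* A cheapest temporal walk from s is computed by Bellman-Ford on the edges: the
   table records, for each edge i, the least cost found so far of a walk from s
   whose last edge is i, and m rounds suffice because a path has at most m edges.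
   Deleting the closed parts of a walk leaves a path that arrives no later and,
   costs being nonnegative, is no more expensive. Both problems thus reduce to
   scanning the table for an edge into z whose arrival time and table entry are
   at most given bounds a and c; the path P is efficient iff no such edge does
   strictly better than a = a(P) or c = c(P). *)
Require Import Defs.
From mathcomp Require Import all_boot all_order all_algebra.
From mathcomp Require Import reals.
From mathcomp Require Import zify.

Set Implicit Arguments.
Unset Strict Implicit.
Unset Printing Implicit Defensive.

Import Order.TTheory GRing.Theory Num.Theory.

Local Open Scope ring_scope.

(** * Runs of programs with a step bound and a postcondition *)

Section Runs.
Variable R : realType.
Implicit Types (p q : program) (st : state R) (Q : state R -> Prop).

(* The commands [q] that follow [p] are arbitrary, so that [runs] composes. *)
Definition runs p n st Q : Prop := exists k st',
  [/\ (k <= n)%N, forall q, iter k (@step R) (p ++ q, st) = (q, st') & Q st'].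

Lemma runs_nil n st Q : Q st -> runs [::] n st Q.
Proof. by move=> Qst; exists 0, st. Qed.

(** [exec] matches on the state; the expanded [State] lets it compute even when [st] is a variable,
    which makes symbolic execution possible. *)
Lemma runs_do i p n st Q :
  runs p n (exec i (State (nreg st) (nmem st) (rreg st) (rmem st))) Q ->
  runs (Do i :: p) n.+1 st Q.
Proof.
case: st => nr nm rr rm /=; set st := State nr nm rr rm.
case=> k [st' [lekn itk Qst']]; exists k.+1, st'.
by split=> // q; rewrite iterSr /= itk.
Qed.

Lemma runs_if b p1 p2 p n st Q :
  runs ((if holds b st then p1 else p2) ++ p) n st Q ->
  runs (If b p1 p2 :: p) n.+1 st Q.
Proof.
case=> k [st' [lekn itk Qst']]; exists k.+1, st'.
by split=> // q; rewrite iterSr /= catA itk.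
Qed.

Lemma runs_cat p q n1 n2 st Q1 Q2 :
  runs p n1 st Q1 -> (forall st', Q1 st' -> runs q n2 st' Q2) ->
  runs (p ++ q) (n1 + n2) st Q2.
Proof.
case=> k1 [st1 [le1 it1 /[swap] /[apply]]] [k2 [st2 [le2 it2 Q2st]]].
exists (k2 + k1)%N, st2; split=> // [|q']; first by rewrite addnC leq_add.
by rewrite -catA iterD it1 it2.
Qed.

Lemma runs_weaken n1 n2 p st Q1 Q2 :
  (n1 <= n2)%N -> (forall st', Q1 st' -> Q2 st') ->
  runs p n1 st Q1 -> runs p n2 st Q2.
Proof.
move=> len Q12 [k [st' [lek itk Q1st]]].
by exists k, st'; split; [exact: leq_trans len | | exact: Q12].
Qed.

(** The index [i] counts the iterations left. Each costs its body plus one step for the test; the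
    outer [.+1] is the failing test. *)
Lemma runs_while b q n (I : nat -> state R -> Prop) i st :
    (forall i st, I i st -> holds b st = (0 < i)%N) ->
    (forall i st, I i.+1 st -> runs q n st (I i)) ->
  I i st -> runs [:: While b q] (i * n.+1).+1 st (I 0).
Proof.
move=> bI qI; elim: i st => [|i IHi] st Ist.
  by exists 1, st; split=> // p; rewrite /= (bI _ _ Ist).
have [k1 [st1 [le1 it1 /IHi [k2 [st2 [le2 it2 Ist2]]]]]] := qI _ _ Ist.
exists (k2 + k1).+1, st2; split=> // [|p]; first by rewrite mulSn; lia.
by rewrite iterSr iterD /= (bI _ _ Ist) it1 it2.
Qed.

Lemma runs_halt p n st Q N : runs p n st Q -> (n <= N)%N ->
  exists2 st', iter N (@step R) (p, st) = ([::], st') & Q st'.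
Proof.
case=> k [st' [lek itk Qst']] leN; exists st' => //.
rewrite -(subnK (leq_trans lek leN)) iterD -[p]cats0 itk.
(* The empty command list is a fixed point of [step], so the surplus steps do nothing. *)
by elim: (N - k)%N => //= j ->.
Qed.

End Runs.

(** * The program *)

(* [rE], [rC], [rF] and [rT] hold the base addresses of the edges (four cells
   each), of their costs, of the flags telling which table entries are defined,
   and of the table. The flags lie behind the input, so they are initially 0.
   [rA] and [xBound] hold the bounds on arrival time and cost. *)
Local Notation rOut := 0%N (only parsing).
Local Notation rOne := 1%N (only parsing).
Local Notation rS := 2%N (only parsing).
Local Notation rZ := 3%N (only parsing).
Local Notation rM := 4%N (only parsing).
Local Notation rE := 5%N (only parsing).
Local Notation rC := 6%N (only parsing).
Local Notation rF := 7%N (only parsing).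
Local Notation rT := 8%N (only parsing).
Local Notation rA := 9%N (only parsing).
Local Notation rRound := 10%N (only parsing).
Local Notation rI := 11%N (only parsing).
Local Notation rJ := 12%N (only parsing).
Local Notation rSrc := 13%N (only parsing).
Local Notation rAvail := 14%N (only parsing).
Local Notation rStrict := 15%N (only parsing).
Local Notation rAddr := 16%N (only parsing).
Local Notation rDst := 17%N (only parsing).
Local Notation rArr := 18%N (only parsing).
Local Notation rFlag := 19%N (only parsing).
Local Notation rAddr2 := 20%N (only parsing).
Local Notation xBound := 0%N (only parsing).
Local Notation xCost := 1%N (only parsing).
Local Notation xNew := 2%N (only parsing).
Local Notation xOld := 3%N (only parsing).

(** Without multiplication, the offset of four cells per edge is obtained by doubling twice. *)
Definition edge_addr x :=
  [:: Do (NAdd rAddr x x); Do (NAdd rAddr rAddr rAddr);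
      Do (NAdd rAddr rE rAddr)].

Definition load_next x := [:: Do (NAdd rAddr rAddr rOne); Do (NLoad x rAddr)].

(** No real stands for infinity, so an entry with flag 0 is written unconditionally; a defined entry
    is overwritten only by a value that is no larger. *)
Definition update : program :=
  [:: Do (NAdd rAddr rF rI); Do (NLoad rFlag rAddr);
      Do (NAdd rAddr2 rT rI); Do (RLoad xOld rAddr2);
      If (NLe rOne rFlag)
        [:: If (RLe xNew xOld) [:: Do (RStore rAddr2 xNew)] [::]]
        [:: Do (RStore rAddr2 xNew); Do (NStore rAddr rOne)]].

(** Loop counters run from [m] down to 1, so [x] is decremented before it serves as an index.
    [rFlag] first holds the traversal time as scratch. *)
Definition load_edge x : program :=
  Do (NSub x x rOne) :: edge_addr x ++ load_next rDst ++ load_next rArr ++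
  load_next rFlag ++
  [:: Do (NAdd rArr rArr rFlag); Do (NAdd rAddr rF x); Do (NLoad rFlag rAddr);
      Do (NAdd rAddr rT x); Do (RLoad xNew rAddr)].

Definition relax : program :=
  load_edge rJ ++
  [:: If (NLe rOne rFlag)
        [:: If (NLe rDst rSrc)
          [:: If (NLe rSrc rDst)
            [:: If (NLe rArr rAvail)
                (Do (RAdd xNew xNew xCost) :: update) [::]] [::]] [::]] [::]].

(** There are no real constants and no copy instruction: [RSub xNew xCost xCost] produces 0, to
    which the cost is added. Two inequality tests express that the edge leaves [s], in which case it
    is a walk by itself. *)
Definition improve_start : program :=
  Do (NSub rI rI rOne) :: edge_addr rI ++
  [:: Do (NLoad rSrc rAddr); Do (NAdd rAddr rAddr rOne)] ++ load_next rAvail ++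
  [:: Do (NAdd rAddr rC rI); Do (RLoad xCost rAddr); Do (RSub xNew xCost xCost);
      Do (RAdd xNew xNew xCost); Do (NConst rJ 0); Do (NAdd rJ rJ rM);
      If (NLe rS rSrc) [:: If (NLe rSrc rS) update [::]] [::]].

Definition improve : program :=
  improve_start ++ [:: While (NLe rOne rJ) relax].

Definition round : program :=
  [:: Do (NSub rRound rRound rOne); Do (NConst rI 0); Do (NAdd rI rI rM)] ++
  [:: While (NLe rOne rI) improve].

Definition bellman_ford : program :=
  [:: Do (NConst rRound 0); Do (NAdd rRound rRound rM)] ++
  [:: While (NLe rOne rRound) round].

Definition check_edge : program :=
  load_edge rI ++
  [:: If (NLe rOne rFlag)
        [:: If (NLe rDst rZ)
          [:: If (NLe rZ rDst)
            [:: If (NLe rArr rA)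
              [:: If (RLe xNew xBound)
                [:: Do (NConst rOut 1);
                    If (NLe rA rArr)
                      [:: If (RLe xBound xNew) [::] [:: Do (NConst rStrict 1)]]
                      [:: Do (NConst rStrict 1)]]
                [::]] [::]] [::]] [::]] [::]].

Definition scan : program :=
  [:: Do (NConst rOut 0); Do (NConst rStrict 0);
      Do (NConst rI 0); Do (NAdd rI rI rM)] ++
  [:: While (NLe rOne rI) check_edge].

Definition core : program := bellman_ford ++ scan.

(** * Correctness of the table *)

Section Core.
Variables (R : realType) (m s z eb cb fb tb a : nat) (c : R).
Variables (eS eD eA eL : nat -> nat) (eC : nat -> R).
Hypothesis edges_below : (eb + 4 * m <= fb)%N.
Hypothesis costs_below : (cb + m <= tb)%N.
Implicit Types (st : state R) (X : nat -> R -> Prop).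

Definition feeds j i := (eD j == eS i) && (eA j + eL j <= eA i)%N.

(* [walk r i d]: at most [r] edges, the last one being [i], of total cost [d]. *)
Inductive walk : nat -> nat -> R -> Prop :=
  | walk1 r i of (i < m)%N & eS i = s : walk r.+1 i (eC i)
  | walkS r j i d of walk r j d & (i < m)%N & feeds j i : walk r.+1 i (d + eC i).

Lemma walk_lt r i d : walk r i d -> (i < m)%N. Proof. by case. Qed.

Lemma walk_inv r i d : walk r.+1 i d ->
  eS i = s /\ d = eC i \/
  exists j d', [/\ walk r j d', feeds j i & d = d' + eC i].
Proof.
by move=> w; inversion w; [left | right; eexists; eexists; split; eauto].
Qed.

(** The sum has the very shape that executing [edge_addr] produces. *)
Definition eaddr i := (eb + (i + i + (i + i)))%N.

Record env st : Prop := Env {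
  envOne : nreg st rOne = 1%N;
  envS : nreg st rS = s;
  envZ : nreg st rZ = z;
  envM : nreg st rM = m;
  envE : nreg st rE = eb;
  envC : nreg st rC = cb;
  envF : nreg st rF = fb;
  envT : nreg st rT = tb;
  envA : nreg st rA = a;
  envB : rreg st xBound = c;
  envmS : forall i, (i < m)%N -> nmem st (eaddr i) = eS i;
  envmD : forall i, (i < m)%N -> nmem st (eaddr i + 1) = eD i;
  envmA : forall i, (i < m)%N -> nmem st (eaddr i + 1 + 1) = eA i;
  envmL : forall i, (i < m)%N -> nmem st (eaddr i + 1 + 1 + 1) = eL i;
  envmC : forall i, (i < m)%N -> rmem st (cb + i) = eC i
}.

Definition flag st i := (0 < nmem st (fb + i))%N.
Definition tab st i := rmem st (tb + i).
(** Completeness of the table: [X] collects the walks accounted for so far, and each loop invariant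
    has its own [X]. *)
Definition covers X st := forall i d, X i d -> flag st i && (tab st i <= d).
(** The number [r] of edges is unrestricted because entries are updated in place, so one round may
    chain several edges. *)
Definition sound st :=
  forall i, (i < m)%N -> flag st i -> exists r, walk r i (tab st i).

(** By [edges_below] and [costs_below], the input cells named in [env] lie below the flags and the
    table, the only cells written. *)
Lemma env_frame st st' : env st ->
    {in [pred x | 0 < x < rRound]%N, nreg st' =1 nreg st} ->
      rreg st' xBound = rreg st xBound ->
    {in gtn fb, nmem st' =1 nmem st} -> {in gtn tb, rmem st' =1 rmem st} ->
  env st'.
Proof.
by move=> [? ? ? ? ? ? ? ? ? ? mS mD mA mL mC] eqn eqr eqnm eqrm;
  split=> [||||||||||i ltim|i ltim|i ltim|i ltim|i ltim];
  rewrite ?eqn ?eqr ?eqnm ?eqrm ?mS ?mD ?mA ?mL ?mC // inE /eaddr /=; lia.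
Qed.

Lemma runs_update st i d X :
    env st -> (i < m)%N -> nreg st rI = i -> rreg st xNew = d ->
    (exists r, walk r i d) -> sound st -> covers X st ->
  runs update 8 st (fun st' =>
    [/\ env st', sound st', covers (fun k e => X k e \/ k = i /\ e = d) st',
        {in gtn rAddr, nreg st' =1 nreg st} & rreg st' xCost = rreg st xCost]).
Proof.
move=> ev ltim nI rN Wd snd cov.
rewrite /update; do 4! (apply: runs_do; rewrite /=).
apply: runs_if; rewrite /= (envOne ev) (envF ev) (envT ev) nI.
have frame x : (x < rAddr)%N ->
    [eta [eta [eta nreg st with rAddr |-> (fb + i)%N] with
      rFlag |-> nmem st (fb + i)] with rAddr2 |-> (tb + i)%N] x = nreg st x.
  by move=> /= ltx; do 3?case: eqP; lia.
have frame10 x : (0 < x < rRound)%N ->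
    [eta [eta [eta nreg st with rAddr |-> (fb + i)%N] with
      rFlag |-> nmem st (fb + i)] with rAddr2 |-> (tb + i)%N] x = nreg st x.
  by move=> ltx; apply: frame; lia.
case: ltnP => [fl|nfl] /=.
  apply: runs_if; rewrite /= rN.
  case: leP => [led|/ltW gtd] /=.
    apply: runs_do; rewrite /= rN; apply: runs_nil; split=> //=.
    - apply: env_frame ev _ _ _ _ => //= x; rewrite inE /= => ltx.
      by case: eqP => //; lia.
    - move=> k ltkm; rewrite /flag /tab /= eqn_add2l.
      by case: eqP => [->|_] // fk; apply: snd.
    - move=> k e; rewrite /flag /tab /= eqn_add2l.
      case=> [/cov /andP[flk le_ke]|[-> ->]]; last by rewrite fl eqxx lexx.
      case: eqP => [eki|_]; apply/andP; split=> //.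
      by rewrite (le_trans led) // -eki.
  apply: runs_nil; split=> //=.
    by apply: env_frame ev _ _ _ _.
  move=> k e [/cov //|[-> ->]]; rewrite /flag /tab /=.
  by rewrite fl.
apply: runs_do; rewrite /= rN.
apply: runs_do; rewrite /= (envOne ev); apply: runs_nil; split=> //=.
- by apply: env_frame ev _ _ _ _ => //= x; rewrite inE /= => ltx;
    case: eqP => //; lia.
- move=> k ltkm; rewrite /flag /tab /= !eqn_add2l.
  by case: eqP => [->|_] // fk; apply: snd.
- move=> k e; rewrite /flag /tab /= !eqn_add2l.
  case=> [/cov /andP[flk le_ke]|[-> ->]]; last by rewrite eqxx lexx.
  case: eqP => [eki|_]; last exact/andP.
  (* This case is void: the flag of [i] was clear, so nothing at [i] was covered before. *)
  by rewrite eki /flag in flk; lia.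
Qed.

Lemma runs_load_edge x i st :
    x \in [:: rI; rJ] -> env st -> (i < m)%N -> nreg st x = i.+1 ->
  runs (load_edge x) 20 st (fun st' =>
    [/\ env st', nreg st' x = i,
        {in gtn rAddr, forall y, y != x -> nreg st' y = nreg st y},
        {in predC1 xNew, rreg st' =1 rreg st} &
    [/\ nmem st' = nmem st, rmem st' = rmem st,
        nreg st' rFlag = nmem st (fb + i), rreg st' xNew = tab st i &
        nreg st' rDst = eD i /\ nreg st' rArr = (eA i + eL i)%N]]).
Proof.
move=> xIJ ev ltim nx.
have post st' : nreg st' x = i ->
    {in gtn rAddr, forall y, y != x -> nreg st' y = nreg st y} ->
    {in predC1 xNew, rreg st' =1 rreg st} -> nmem st' = nmem st ->
    rmem st' = rmem st -> env st'.
  move=> ex en er nm rm; apply: env_frame ev _ _ _ _; rewrite ?er ?nm ?rm //.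
  move=> y; rewrite inE /= => lty; apply: en; first by rewrite inE /=; lia.
  by move: xIJ; rewrite !inE => /orP[]/eqP ->; apply/eqP; lia.
move: xIJ nx; rewrite /load_edge !inE => /orP[]/eqP ex; rewrite ex => nx;
  do 15! (apply: runs_do;
          rewrite /= ?nx ?subn1 ?(envOne ev) ?(envE ev) ?(envF ev) ?(envT ev));
  apply: runs_nil; set st' := State _ _ _ _;
  (have fr : {in gtn rAddr, forall y, y != x -> nreg st' y = nreg st y} by
     move=> y; rewrite inE ex /= => lty /negPf ->; do 9?case: eqP => //; lia);
  (have frr : {in predC1 xNew, rreg st' =1 rreg st} by
     move=> y; rewrite inE /= => /negPf ->);
  (have evst : env st' by apply: post => //; rewrite ex);
  rewrite ex in fr; split=> //; split=> //;
  by rewrite /= -(envmD ev ltim) -(envmA ev ltim) -(envmL ev ltim).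
Qed.

(* What the table covers during round [r] once the edges after [i] have been
   improved and [i] has been relaxed with the edges from [j] on. *)
Definition relaxed r i j k e :=
  [\/ walk r k e, (i < k)%N /\ walk r.+1 k e, [/\ k = i, eS i = s & e = eC i] |
   exists j' d, [/\ (j <= j')%N, walk r j' d, feeds j' i, k = i & e = d + eC i]].

Definition relax_inv r n i j st :=
  [/\ env st, sound st, covers (relaxed r i j) st, (i < m)%N /\ (j <= m)%N &
  [/\ nreg st rRound = n, nreg st rI = i, nreg st rJ = j, nreg st rSrc = eS i &
      nreg st rAvail = eA i /\ rreg st xCost = eC i]].

Lemma runs_relax r n i j st :
  relax_inv r n i j.+1 st -> runs relax 33 st (relax_inv r n i j).
Proof.
case=> ev sd cov [ltim ltjm] [nR nI nJ nSr [nAv xC]].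
apply: (runs_cat (n1 := 20) (n2 := 13)) (runs_load_edge _ ev ltjm nJ) _ => //.
move=> st1 [ev1 n1J n1 r1 [nm1 rm1 nF xN [nD nA]]].
have sd1 : sound st1 by rewrite /sound /flag /tab nm1 rm1.
have cov1 : covers (relaxed r i j.+1) st1.
  by rewrite /covers /flag /tab nm1 rm1.
have n1R : nreg st1 rRound = n by rewrite n1.
have n1I : nreg st1 rI = i by rewrite n1.
have n1S : nreg st1 rSrc = eS i by rewrite n1.
have n1A : nreg st1 rAvail = eA i by rewrite n1.
have r1C : rreg st1 xCost = eC i by rewrite r1.
(* If a test fails, no walk ending in [j] extends by [i], so passing from [j.+1] to [j] adds no
   obligation. *)
have skip k : (forall d, walk r j d -> feeds j i -> False) ->
    runs [::] k st1 (relax_inv r n i j).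
  move=> skip; apply: runs_nil; split=> //; last by split; rewrite // ltnW.
  move=> k' e re; apply: cov1; case: re => [| | |[j' [d [le_j w f -> ->]]]].
  - by constructor 1.
  - by constructor 2.
  - by constructor 3.
  constructor 4; exists j', d; split=> //.
  by rewrite ltn_neqAle le_j andbT; apply/eqP => eqj; subst j'; exact: skip w f.
apply: runs_if; rewrite /= (envOne ev1) nF;
  case: ltnP => [fl|nfl] /=; last first.
  (* A walk of at most [r] edges ending in [j] would be covered, hence flagged. *)
  apply: skip => d w _;
    have /cov/andP[] : relaxed r i j.+1 j d by constructor 1.
  by rewrite /flag; lia.
apply: runs_if; rewrite /= nD n1S; case: leqP => [le1|gt1] /=; last first.
  by apply: skip => d _ /andP[/eqP]; lia.
apply: runs_if; rewrite /= nD n1S; case: leqP => [le2|gt2] /=; last first.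
  by apply: skip => d _ /andP[/eqP]; lia.
apply: runs_if; rewrite /= nA n1A; case: leqP => [le3|gt3] /=; last first.
  by apply: skip => d _ /andP[_]; lia.
have folji : feeds j i by rewrite /feeds le3 andbT eqn_leq le1.
apply: runs_do; rewrite /=; set st2 := State _ _ _ _.
have ev2 : env st2 by apply: env_frame ev1 _ _ _ _.
have Wd : exists r', walk r' i (rreg st2 xNew).
  have [r' w] := sd _ ltjm fl; exists r'.+1.
  by rewrite /= xN r1C; apply: walkS w ltim folji.
apply: runs_weaken (runs_update ev2 ltim n1I (erefl _) Wd sd1 cov1) => //.
move=> st3 [ev3 sd3 cov3 n3 r3]; split=> //.
- move=> k e re; case: re => [w|w|w|[j' [d [le_j w f -> ->]]]].
  - by apply: cov3; left; constructor 1.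
  - by apply: cov3; left; constructor 2.
  - by apply: cov3; left; constructor 3.
  move: le_j; rewrite leq_eqVlt => /orP[/eqP eqj|lt_j]; last first.
    by apply: cov3; left; constructor 4; exists j', d.
  (* The entry at [i] is now at most the old entry at [j] plus the cost of [i], and the entry at [j]
     is at most [d]. *)
  have /cov3/andP[-> /= /le_trans -> //] :
    relaxed r i j.+1 i (rreg st2 xNew) \/
      i = i /\ rreg st2 xNew = rreg st2 xNew.
    by right.
  rewrite /= xN r1C lerD2r; subst j'.
  by have /cov/andP[] : relaxed r i j.+1 j d by constructor 1.
- by split; rewrite // ltnW.
by split; rewrite ?n3 ?r3.
Qed.

Definition improve_inv r n i st :=
  [/\ env st, sound st,
      covers (fun k e => walk r k e \/ (i <= k)%N /\ walk r.+1 k e) st,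
      nreg st rRound = n & nreg st rI = i /\ (i <= m)%N].

Lemma runs_improve_start r n i st :
  improve_inv r n i.+1 st -> runs improve_start 24 st (relax_inv r n i m).
Proof.
case=> ev sd cov nR [nI ltim]; rewrite /improve_start.
do 14! (apply: runs_do;
  rewrite /= ?nI ?subn1 ?(envOne ev) ?(envE ev) ?(envC ev) ?(envM ev)).
rewrite add0n -!/(eaddr i) (envmS ev ltim) (envmA ev ltim)
  (envmC ev ltim) subrK.
set st1 := State _ _ _ _.
have ev1 : env st1.
  by apply: env_frame ev _ _ _ _ => // y; rewrite inE /= => lty;
     do 6?case: eqP => //; lia.
(* With [j] equal to [m] the fourth case is empty, since a walk ends in an edge below [m]. *)
have relaxedE k e : relaxed r i m k e ->
    walk r k e \/ (i.+1 <= k)%N /\ walk r.+1 k e \/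
      [/\ k = i, eS i = s & e = eC i].
  case=> [|||[j [d [le_m /walk_lt]]]];
    [by left|by right; left|by right;right|lia].
have skip k : eS i <> s -> runs [::] k st1 (relax_inv r n i m).
  move=> neqs; apply: runs_nil; split=> // k' e /relaxedE re.
  by apply: cov; case: re => [|[|[]]]; [left|right|].
apply: runs_if; rewrite /= (envS ev); case: leqP => [le1|gt1] /=; last first.
  by apply: skip; lia.
apply: runs_if; rewrite /= (envS ev); case: leqP => [le2|gt2] /=; last first.
  by apply: skip; lia.
have eqs : eS i = s by lia.
have Wd : exists r', walk r' i (eC i) by exists 1%N; apply: walk1.
apply: runs_weaken (runs_update ev1 ltim (erefl _) (erefl _) Wd sd cov) => //.
move=> st2 [ev2 sd2 cov2 n2 r2]; split; rewrite ?n2 ?r2 // => k e /relaxedE re.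
by apply: cov2; case: re => [|[|[-> _ ->]]]; [left; left|left; right|right].
Qed.

(** By [walk_inv], a walk ending in [i] is either the edge [i] out of [s] or extends a shorter walk;
    [improve_start] and the loop over predecessors treat these two cases. *)
Lemma runs_improve r n i st : improve_inv r n i.+1 st ->
  runs improve (24 + (m * 34).+1) st (improve_inv r n i).
Proof.
move=> /runs_improve_start /runs_cat; apply=> st1 inv1.
apply: runs_weaken (runs_while (I := relax_inv r n i) _ _ inv1) => //.
- move=> st2 [ev2 sd2 cov2 [ltim _] [nR nI _ _ _]];
    split; rewrite // ?(ltnW ltim) //.
  move=> k e w; apply: cov2; case: w => [w|[]]; first by constructor 1.
  rewrite leq_eqVlt => /orP[/eqP <-|ltik w]; last by constructor 2.
  case/walk_inv=> [[eqs ->]|[j [d [w f ->]]]]; first by constructor 3.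
  by constructor 4; exists j, d.
- by move=> j st2 [ev2 _ _ _ [_ _ nJ _ _]]; rewrite /= nJ (envOne ev2).
- by move=> j st2; exact: runs_relax.
Qed.

(** Here [n] rounds remain and [m - n] are done. *)
Definition round_inv n st :=
  [/\ env st, sound st, covers (walk (m - n)) st, nreg st rRound = n & (n <= m)%N].

Lemma runs_round n st : round_inv n.+1 st ->
  runs round (3 + (m * (24 + (m * 34).+1).+1).+1) st (round_inv n).
Proof.
case=> ev sd cov nR ltnm; rewrite /round /=.
do 3! (apply: runs_do; rewrite /= ?nR ?subn1 ?(envOne ev) ?(envM ev)).
set st1 := State _ _ _ _.
have ev1 : env st1.
  by apply: env_frame ev _ _ _ _ => // y; rewrite inE /= => lty;
     do 3?case: eqP => //; lia.
have inv1 : improve_inv (m - n.+1) n m st1.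
  split=> // k e w; apply: cov; case: w => // -[lemk /walk_lt]; lia.
apply: runs_weaken (runs_while _ _ inv1) => //.
- move=> st2 [ev2 sd2 cov2 nR2 _]; split=> // [k e w|]; last exact: ltnW.
  by apply: cov2; right; rewrite subnSK.
- by move=> i st2 [ev2 _ _ _ [nI _]]; rewrite /= nI (envOne ev2).
- by move=> i st2; exact: runs_improve.
Qed.

Lemma runs_bellman_ford st :
    env st -> (forall i, (i < m)%N -> nmem st (fb + i) = 0%N) ->
  runs bellman_ford (2 + (m * (3 + (m * (24 + (m * 34).+1).+1).+1).+1).+1) st
    (fun st' => [/\ env st', sound st' & covers (walk m) st']).
Proof.
move=> ev fl0; rewrite /bellman_ford /=.
do 2! (apply: runs_do; rewrite /= ?(envOne ev) ?(envM ev)).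
set st1 := State _ _ _ _.
have ev1 : env st1.
  by apply: env_frame ev _ _ _ _ => // y; rewrite inE /= => lty;
     do 3?case: eqP => //; lia.
have inv1 : round_inv m st1.
  (* All flags are 0, so soundness is vacuous, and there is no walk of at most 0 edges to cover. *)
  split=> // [i ltim|i d]; first by rewrite /flag /= fl0.
  by rewrite subnn => w; inversion w.
apply: runs_weaken (runs_while _ _ inv1) => //.
- by move=> st2 [ev2 sd2 cov2 nR2 _]; split=> //; rewrite subn0 in cov2.
- by move=> i st2 [ev2 _ _ nR _]; rewrite /= nR (envOne ev2).
- by move=> i st2; exact: runs_round.
Qed.

(** * Scanning the table *)

Definition good st i :=
  [&& flag st i, eD i == z, (eA i + eL i <= a)%N & tab st i <= c].
(** When [a] and [c] are the arrival time and cost of a path, this is domination of that path. *)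
Definition better st i :=
  good st i && ((eA i + eL i < a)%N || (tab st i < c)).

Definition scan_inv st0 n st :=
  [/\ env st, nmem st = nmem st0 /\ rmem st = rmem st0, nreg st rI = n /\ (n <= m)%N,
      nreg st rOut = has (good st0) (iota n (m - n)) :> nat &
      nreg st rStrict = has (better st0) (iota n (m - n)) :> nat].

Lemma runs_check_edge st0 n st : scan_inv st0 n.+1 st ->
  runs check_edge 29 st (scan_inv st0 n).
Proof.
case=> ev [nm rm] [nI ltnm] out strict.
apply: (runs_cat (n1 := 20) (n2 := 9)) (runs_load_edge _ ev ltnm nI) _ => //.
move=> st1 [ev1 n1I n1 r1 [nm1 rm1 nF xN [nD nA]]].
have tabE : tab st n = tab st0 n by rewrite /tab rm.
have flagE : nmem st (fb + n) = nmem st0 (fb + n) by rewrite nm.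
have iotaE : iota n (m - n) = n :: iota n.+1 (m - n.+1) by rewrite -subnSK.
have nO : nreg st1 rOut = nreg st rOut by rewrite n1.
have nS : nreg st1 rStrict = nreg st rStrict by rewrite n1.
have skip k : ~~ good st0 n -> runs [::] k st1 (scan_inv st0 n).
  move=> bad; apply: runs_nil; split; rewrite ?nm1 ?rm1 ?nO ?nS //.
  - by split=> //; exact: ltnW.
  - by rewrite iotaE /= (negPf bad).
  - by rewrite iotaE /= /better (negPf bad).
apply: runs_if; rewrite /= (envOne ev1) nF flagE;
  case: ltnP => [fl|nfl] /=; last first.
  by apply: skip; rewrite /good /flag; lia.
apply: runs_if; rewrite /= nD (envZ ev1);
  case: leqP => [le1|gt1] /=; last first.
  by apply: skip; rewrite /good; lia.
apply: runs_if; rewrite /= nD (envZ ev1);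
  case: leqP => [le2|gt2] /=; last first.
  by apply: skip; rewrite /good; lia.
apply: runs_if; rewrite /= nA (envA ev1);
  case: leqP => [le3|gt3] /=; last first.
  by apply: skip; rewrite /good; lia.
apply: runs_if; rewrite /= xN (envB ev1) tabE;
  case: ifP => [le4|gt4] /=; last first.
  by apply: skip; rewrite /good gt4 !andbF.
have eqz : eD n = z by apply/eqP; rewrite eqn_leq le1.
have gd : good st0 n by rewrite /good /flag fl le3 le4 eqz eqxx.
(* [rStrict] holds a truth value, so [!= 0] recovers the verdict on the edges scanned before. *)
have post f : f rOut = 1%N ->
  f rStrict = better st0 n || (nreg st rStrict != 0%N) :> nat ->
    (forall x, x != rOut -> x != rStrict -> f x = nreg st1 x) ->
    scan_inv st0 n (State f (nmem st1) (rreg st1) (rmem st1)).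
  move=> fO fS fK; have evf : env (State f (nmem st1) (rreg st1) (rmem st1)).
    by apply: env_frame ev1 _ _ _ _ => // x; rewrite inE /= => ltx; apply: fK;
      apply/eqP; lia.
  split; rewrite /= ?fO ?fS ?fK //.
  - by rewrite nm1 rm1.
  - by rewrite n1I; split=> //; exact: ltnW.
  - by rewrite iotaE /= gd.
  - by rewrite iotaE /= strict eqb0 negbK.
apply: runs_do; rewrite /=; apply: runs_if; rewrite /= nA (envA ev1).
have strictly : better st0 n -> runs [:: Do (NConst rStrict 1)] 1
    (State [eta nreg st1 with rOut |-> 1%N] (nmem st1) (rreg st1) (rmem st1))
    (scan_inv st0 n).
  move=> bt; apply: runs_do; apply: runs_nil; apply: post => //=.
    by rewrite bt.
  by move=> x /negPf -> /negPf ->.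
case: leqP => [le5|gt5] /=; last first.
  by apply: runs_weaken (strictly _) => //; rewrite /better gd gt5.
apply: runs_if; rewrite /= xN (envB ev1) tabE.
case: leP => [le6|gt6] /=; last by apply: strictly; rewrite /better gd gt6 orbT.
apply: runs_nil; apply: post => //= [|x /negPf -> //].
by rewrite nS strict /better gd ltNge le6 ltnNge le5 /= eqb0 negbK.
Qed.

(** Rounds, improved edges and predecessors form three nested loops of length [m], hence a cubic
    bound; the last summand is the linear scan. *)
Definition core_bound :=
  (2 + (m * (3 + (m * (24 + (m * 34).+1).+1).+1).+1).+1 + (4 + (m * 30).+1))%N.

Lemma runs_core st :
    env st -> (forall i, (i < m)%N -> nmem st (fb + i) = 0%N) ->
  runs core core_bound st (fun st' => exists st0,
    [/\ env st', sound st0, covers (walk m) st0,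
        nreg st' rOut = has (good st0) (iota 0 m) :> nat &
        nreg st' rStrict = has (better st0) (iota 0 m) :> nat]).
Proof.
move=> ev fl0; apply: runs_cat (runs_bellman_ford ev fl0) _.
move=> st0 [ev0 sd0 cov0]; rewrite /scan /=.
do 4! (apply: runs_do; rewrite /= ?(envOne ev0) ?(envM ev0)).
set st1 := State _ _ _ _.
have ev1 : env st1.
  by apply: env_frame ev0 _ _ _ _ => // y; rewrite inE /= => lty;
     do 5?case: eqP => //; lia.
have inv1 : scan_inv st0 m st1 by split=> //; rewrite subnn.
apply: runs_weaken (runs_while _ _ inv1) => //.
- by move=> st2 [ev2 _ _]; rewrite subn0 => out strict; exists st0.
- by move=> i st2 [ev2 _ [nR _] _ _]; rewrite /= nR (envOne ev2).
- by move=> i st2; exact: runs_check_edge.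
Qed.

Lemma core_bound_le : (core_bound <= 200 * m.+1 ^ 3)%N.
Proof. by clear; rewrite /core_bound; nia. Qed.

End Core.

(** * Walks and paths *)

Section Graph.
Variables (R : realType) (G : tgraph R).
Implicit Types (u v w : vertices G) (e f : tedge (vertices G) R).
Implicit Types P Q : seq (tedge (vertices G) R).

(** The end is the head of the last edge, and the start differs from all heads. *)
Lemma is_path_neq u v P : is_path u v P -> u != v.
Proof.
case: P => //= e p /and5P[_ _ /eqP <- /eqP <- /andP[]].
by rewrite -map_cons => /(contraNneq _) + _;
  apply=> ->; rewrite map_f ?mem_last.
Qed.

Lemma is_path_single e : e \in edges G -> is_path (src e) (dst e) [:: e].
Proof. by move=> eG; rewrite /= eG !eqxx !inE edges_loopless. Qed.

Lemma is_path_rcons u v P e :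
    is_path u v P -> e \in edges G -> src e = v -> (arrival P <= avail e)%N ->
    dst e \notin u :: [seq dst f | f <- P] ->
  is_path u (dst e) (rcons P e).
Proof.
case: P => // f p /and5P[inG fol /eqP <- /eqP dv uq] eG se arr nd.
apply/and5P; split=> //.
- by rewrite -rcons_cons all_rcons inG andbT.
- by rewrite rcons_path fol /follows dv se eqxx.
- by rewrite last_rcons.
- by rewrite -rcons_cons map_rcons -rcons_cons rcons_uniq uq nd.
Qed.

Lemma arrival_monotone e p : path (@follows R G) e p ->
  (avail e + trav e <= avail (last e p) + trav (last e p))%N.
Proof.
elim: p e => //= f p IHp e /andP[/andP[_ le_ef] /IHp]; apply: leq_trans.
exact: leq_trans le_ef (leq_addr _ _).
Qed.

(** Cut the path at the edge into [w]: the edges removed have nonnegative cost and, by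
    [arrival_monotone], do not bring the arrival forward. *)
Lemma is_path_prefix u v P w : is_path u v P -> w \in [seq dst f | f <- P] ->
  exists Q, [/\ is_path u w Q, (arrival Q <= arrival P)%N &
                path_cost Q <= path_cost P].
Proof.
case: P => // e p pP /mapP[f fp ->]; case/splitPl: fp pP => p1 p2 lf.
case/and5P=> inG; rewrite cat_path last_cat => /andP[fol1 fol2] su _ uq.
exists (e :: p1); split.
- apply/and5P; split=> //; last 1 first.
  + by move: uq; rewrite -cat_cons map_cat -cat_cons cat_uniq => /andP[].
  + by move: inG; rewrite -cat_cons all_cat => /andP[].
  + by rewrite lf.
- by rewrite /= last_cat; apply: arrival_monotone.
- rewrite /path_cost -cat_cons big_cat lerDl big_seq; apply: sumr_ge0 => g gp2.
  apply: edges_cost_ge0; apply: (allP inG).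
  by rewrite -cat_cons mem_cat gp2 orbT.
Qed.

Variables s z : vertices G.

Let e0 := TEdge s s 0 0 (0 : R).
Definition eat := nth e0 (edges G).
Definition eS i := vertex_code (src (eat i)).
Definition eD i := vertex_code (dst (eat i)).
Definition eA i := avail (eat i).
Definition eL i := trav (eat i).
Definition eC i := cost (eat i).
Local Notation m := (size (edges G)).
Local Notation walk := (walk m (vertex_code s) eS eD eA eL eC).

Lemma vertex_code_inj : injective (@vertex_code (vertices G)).
Proof. by move=> u v /val_inj/enum_rank_inj. Qed.

Lemma walk_ge0 r i d : walk r i d -> 0 <= d.
Proof.
have C0 j : (j < m)%N -> 0 <= eC j.
  by move=> ltjm; apply: edges_cost_ge0; apply: mem_nth.
elim=> {r i d} [r i ltim _|r j i d _ d0 ltim _]; first exact: C0.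
by rewrite addr_ge0 ?C0.
Qed.

(* Shortcutting: the first edge back to [s] restarts the path, and an edge back
   to another visited vertex is replaced by the prefix ending there. *)
Lemma walk_path r i d : walk r i d -> dst (eat i) = s \/
  exists Q, [/\ is_path s (dst (eat i)) Q, (arrival Q <= eA i + eL i)%N &
                path_cost Q <= d].
Proof.
have single j : (j < m)%N -> src (eat j) = s ->
    exists Q, [/\ is_path s (dst (eat j)) Q, (arrival Q <= eA j + eL j)%N &
                path_cost Q <= eC j].
  move=> ltjm <-; exists [:: eat j]; split=> //;
    last by rewrite /path_cost big_seq1.
  by apply: is_path_single; apply: mem_nth.
elim=> {r i d} [r i ltim /vertex_code_inj sis|r j i d w IH ltim].
  by right; apply: single.
case/andP=> /eqP/vertex_code_inj dj lej.
case: (eqVneq (dst (eat i)) s) => [|nds]; [by left|right].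
have iG : eat i \in edges G by apply: mem_nth.
have Ci : 0 <= eC i by apply: edges_cost_ge0.
case: IH => [dsj|[Q [pQ aQ cQ]]].
  have [|Q [pQ aQ cQ]] := single i ltim; first by rewrite -dj.
  exists Q; split=> //; apply: le_trans cQ _.
  by rewrite lerDr (walk_ge0 w).
have le_i : (arrival Q <= eA i)%N by apply: leq_trans lej.
have [inQ|ninQ] := boolP (dst (eat i) \in [seq dst f | f <- Q]).
  have [Q' [pQ' aQ' cQ']] := is_path_prefix pQ inQ; exists Q'; split=> //.
    by rewrite (leq_trans aQ') // (leq_trans le_i) ?leq_addr.
  by rewrite (le_trans cQ') // (le_trans cQ) // lerDl.
exists (rcons Q (eat i)); split.
- by apply: is_path_rcons pQ iG _ _ _ => //; rewrite inE negb_or nds.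
- by case: (Q) pQ => //= f p _; rewrite last_rcons.
- by rewrite /path_cost -cats1 big_cat big_seq1 lerD2r.
Qed.

Lemma walk_leq r r' i d : (r <= r')%N -> walk r i d -> walk r' i d.
Proof.
move=> + w; elim: w r' =>
  {r i d} [r i ltim si|r j i d _ IH ltim f] [|r'] // le_r.
  exact: walk1.
by apply: walkS f => //; apply: IH.
Qed.

Lemma path_walk v P : is_path s v P -> exists i,
  [/\ walk m i (path_cost P), dst (eat i) = v & (eA i + eL i)%N = arrival P].
Proof.
(* Distinct vertices make the edges of [P] distinct, so there are at most [m] of them. *)
move=> pP; have leP : (size P <= m)%N.
  case: P pP => // e p /and5P[/allP inG _ _ _].
  by rewrite cons_uniq => /andP[_ /map_uniq uP]; exact: uniq_leq_size.
case: P pP leP => // e p /and5P[inG fol /eqP se /eqP <- _] leP.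
have idx f : f \in edges G -> exists2 i, (i < m)%N & eat i = f.
  by move=> fG; exists (index f (edges G)); rewrite /eat ?index_mem ?nth_index.
suff [i [w ei]] : exists i, walk (size (e :: p)) i (path_cost (e :: p)) /\
    eat i = last e p.
  exists i; split; [exact: walk_leq w | by rewrite ei | ].
  by rewrite /eA /eL ei.
elim/last_ind: p inG fol {leP} => [|p f IHp].
  rewrite /= andbT => /idx[i ltim ei] _; exists i; split=> //.
  have -> : path_cost [:: e] = eC i by rewrite /path_cost big_seq1 /eC ei.
  by apply: walk1 => //; rewrite /eS ei se.
rewrite -rcons_cons all_rcons rcons_path => /andP[/idx[i ltim ei] inG].
case/andP=> fol /andP[/eqP df le_f]; have [j [w ej]] := IHp inG fol.
exists i; rewrite last_rcons size_rcons; split=> //.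
have -> : path_cost (rcons (e :: p) f) = path_cost (e :: p) + eC i.
  by rewrite /path_cost -cats1 big_cat big_seq1 /eC ei.
apply: walkS w ltim _.
by rewrite /feeds /eD /eS /eA /eL ei ej df eqxx.
Qed.

(** Downward closure of [K] lets a walk be replaced by the path from [walk_path], and a path by the
    table entry that is no larger. Since [s != z], an edge into [z] does not fall under the closed
    case of [walk_path]. Each problem supplies its own [K]. *)
Lemma table_path (fb tb : nat) (st : state R) (K : nat -> R -> bool) :
    s != z ->
    sound m (vertex_code s) fb tb eS eD eA eL eC st ->
    covers fb tb (walk m) st ->
    (forall a a' c c', K a c -> (a' <= a)%N -> c' <= c -> K a' c') ->
  reflect (exists2 P, is_path s z P & K (arrival P) (path_cost P))
    (has (fun i => [&& flag fb st i, eD i == vertex_code z &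
                    K (eA i + eL i)%N (tab tb st i)]) (iota 0 m)).
Proof.
move=> nsz sd cov Kle; apply: (iffP hasP) => [[i]|[P pP KP]].
  rewrite mem_iota => /= ltim /and3P[fl /eqP/vertex_code_inj di Ki].
  have [r /walk_path] := sd _ ltim fl; rewrite di => -[zs|[Q [pQ aQ cQ]]].
    by rewrite zs eqxx in nsz.
  by exists Q => //; apply: Kle Ki _ _.
have [i [w di ai]] := path_walk pP; have /andP[fl le_i] := cov _ _ w.
exists i; first by rewrite mem_iota /= add0n (walk_lt w).
by rewrite fl /eD di eqxx ai (Kle _ _ _ _ KP).
Qed.

End Graph.

(** * Encoding of the instances *)

Section Encoding.
Variable R : realType.

Lemma size_edges_code (V : finType) (es : seq (tedge V R)) :
  size (edges_code es) = (4 * size es)%N.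
Proof. by elim: es => //= e es IHes; rewrite mulnS -IHes. Qed.

Lemma nth_edges_code (V : finType) e0 (es : seq (tedge V R)) l i :
    (i < size es)%N ->
  let w := edges_code es ++ l in
  let e := nth e0 es i in
  [/\ nth 0%N w (i + i + (i + i)) = vertex_code (src e),
      nth 0%N w (i + i + (i + i) + 1) = vertex_code (dst e),
      nth 0%N w (i + i + (i + i) + 1 + 1) = avail e &
      nth 0%N w (i + i + (i + i) + 1 + 1 + 1) = trav e].
Proof.
elim: es i => //= e es IHes [_|i /IHes] //=.
by rewrite !addnS !addSn.
Qed.

Lemma nth_graph_code (G : tgraph R) pre rest :
  let w := pre ++ graph_code G ++ rest in
  let n := #|vertices G| in
  [/\ nth 0%N w (size pre) = n, nth 0%N w (size pre + n + 1) = size (edges G) &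
      forall k, nth 0%N w (size pre + n + 1 + 1 + k) =
                nth 0%N (edges_code (edges G) ++ rest) k].
Proof.
have -> : pre ++ graph_code G ++ rest =
    pre ++ #|vertices G| :: [seq vertex_code v | v <- enum (vertices G)] ++
    size (edges G) :: edges_code (edges G) ++ rest.
  by rewrite /graph_code cat_cons -catA.
set vs := map _ _; have svs : size vs = #|vertices G| by rewrite size_map -cardE.
have nth_shift j : nth 0%N (pre ++ #|vertices G| :: vs ++
    size (edges G) :: edges_code (edges G) ++ rest)
      (size pre + #|vertices G| + 1 + j)
    = nth 0%N (size (edges G) :: edges_code (edges G) ++ rest) j.
  have -> : (size pre + #|vertices G| + 1 + j = size pre + (#|vertices G| + j).+1)%N.
    by lia.
  rewrite nth_cat ltnNge leq_addr addKn /=.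
  by rewrite nth_cat svs ltnNge leq_addr /= addKn.
split=> [||k].
- by rewrite nth_cat ltnn subnn.
- by rewrite -[X in nth _ _ X]addn0 nth_shift.
by rewrite -addnA nth_shift.
Qed.

(** Every natural, even 0, has bit length at least 1. *)
Lemma size_input_size (w : seq nat * seq R) : (size w.1 <= input_size w)%N.
Proof.
rewrite /input_size -sum1_size (leq_trans _ (leq_addr _ _)) //.
by apply: leq_sum => n _; rewrite /bit_length.
Qed.

Lemma polytime_intro X (code : X -> seq nat * seq R) L p c k :
    (forall x, runs p (c * input_size (code x) ^ k + c) (init (code x))
                 (fun st => nreg st 0 <> 0%N <-> L x)) ->
  polytime_decidable code L.
Proof.
move=> runp; exists p, c, k => x;
  have [st' -> //] := runs_halt (runp x) (leqnn _).
Qed.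

End Encoding.

(** * Programs for the two problems *)

(** On entry [rE] is the address of the vertex count; on exit it is that of the first edge, and [rF]
    is the first address behind the edges. In between, [rM] holds the vertex count. *)
Definition layout : program :=
  [:: Do (NLoad rM rE); Do (NAdd rE rE rM); Do (NAdd rE rE rOne);
      Do (NLoad rM rE); Do (NAdd rE rE rOne); Do (NAdd rF rM rM);
      Do (NAdd rF rF rF); Do (NAdd rF rE rF)].

(** [rOut] is still 0 and [rOne] is 1, so they double as addresses. Real cell 0 holds the cost
    bound, so the edge costs start at 1. *)
Definition bounded_path_start : program :=
  [:: Do (NConst rOne 1); Do (NLoad rS rOut); Do (NLoad rZ rOne);
      Do (NAdd rA rOne rOne); Do (NLoad rA rA); Do (RLoad xBound rOut);
      Do (NConst rE 3)] ++
  layout ++ [:: Do (NConst rC 1); Do (NAdd rT rC rM)].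

(** No path joins a vertex to itself, but the table may contain closed walks; the final test
    therefore answers no when [s] and [z] coincide. *)
Definition bounded_path_program : program :=
  bounded_path_start ++ core ++
  [:: If (NLe rS rZ) [:: If (NLe rZ rS) [:: Do (NConst rOut 0)] [::]] [::]].

(** After [layout], [rF] points at the length of [P]. Advancing by four times that length reaches
    the last traversal time, preceded by the availability; they sum to the arrival time. [rC] keeps
    its initial value 0, where the edge costs begin. *)
Definition efficiency_start : program :=
  [:: Do (NConst rOne 1); Do (NLoad rS rOut); Do (NLoad rZ rOne);
      Do (NConst rE 2)] ++
  layout ++
  [:: Do (NLoad rI rF); Do (NAdd rAddr rI rI); Do (NAdd rAddr rAddr rAddr);
      Do (NAdd rF rF rAddr); Do (NLoad rA rF); Do (NSub rAddr rF rOne);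
      Do (NLoad rArr rAddr); Do (NAdd rA rA rArr); Do (NAdd rF rF rOne);
      Do (NAdd rT rM rI)].

Definition sum_costs : program :=
  [:: While (NLe rOne rI)
    [:: Do (NSub rI rI rOne); Do (NAdd rAddr rM rI); Do (RLoad xNew rAddr);
        Do (RAdd xBound xNew xBound)]].

Definition efficiency_program : program :=
  efficiency_start ++ sum_costs ++ core ++ [:: Do (NSub rOut rOne rStrict)].

(** * Correctness and running time of the two programs *)

Section Decide.
Variable R : realType.

Lemma runs_sum_costs (st : state R) k :
    nreg st rOne = 1%N -> nreg st rI = k -> rreg st xBound = 0 ->
  runs sum_costs (k * 5).+1 st (fun st' =>
    [/\ {in gtn rRound, nreg st' =1 nreg st}, nmem st' = nmem st,
        rmem st' = rmem st &
        rreg st' xBound = \sum_(0 <= i < k) rmem st (nreg st rM + i)]).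
Proof.
move=> n1 nI rB.
pose inv i (st' : state R) :=
  [/\ {in gtn rRound, nreg st' =1 nreg st}, nmem st' = nmem st,
      rmem st' = rmem st, nreg st' rI = i /\ (i <= k)%N &
      rreg st' xBound = \sum_(i <= i < k) rmem st (nreg st rM + i)].
have inv0 : inv k st by split=> //; rewrite big_geq.
apply: runs_weaken (runs_while (n := 4) _ _ inv0) => //.
- by move=> st' [].
- by move=> i st' [nst _ _ [nI' _] _]; rewrite /= nI' nst // n1.
move=> i st' [nst nm rm [nI' ltik] sum].
have n1' : nreg st' rOne = 1%N by rewrite nst.
have nM' : nreg st' rM = nreg st rM by rewrite nst.
do 4! (apply: runs_do; rewrite /= ?nI' ?n1' ?nM' ?subn1).
apply: runs_nil; split=> //=; last by rewrite big_ltn // sum rm.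
- by move=> x /[dup] /nst <-; rewrite inE /= => ltx; do 2?case: eqP => //; lia.
- by split=> //; apply: ltnW.
Qed.

Lemma nth_eaddr (G : tgraph R) (s : vertices G) rest eb f i :
    (forall k, f (eb + k)%N = nth 0%N (edges_code (edges G) ++ rest) k) ->
    (i < size (edges G))%N ->
  [/\ f (eaddr eb i) = eS s i, f (eaddr eb i + 1)%N = eD s i,
      f (eaddr eb i + 1 + 1)%N = eA s i &
      f (eaddr eb i + 1 + 1 + 1)%N = eL s i].
Proof.
move=> fE ltim; have := nth_edges_code (TEdge s s 0 0 0) rest ltim.
by rewrite /eaddr /= -!addnA !fE.
Qed.

Lemma bounded_path_decidable :
  polytime_decidable (@bounded_path_code R)
    (fun x => exists P : seq (tedge (vertices (bp_graph x)) R),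
       [/\ is_path (bp_s x) (bp_z x) P,
           (arrival P <= bp_arrival x)%N
         & path_cost P <= bp_cost x]).
Proof.
(* The input has at least [m.+1] cells, so 200 times the cube from [core_bound_le] and 20 further
   steps fit. *)
apply: (@polytime_intro _ _ _ _ bounded_path_program 300 3) =>
  -[G s z c c0 a] /=.
set code := bounded_path_code _; set m := size (edges G);
  set Q := (Q in runs _ _ _ Q).
have nm : code.1 = [:: vertex_code s; vertex_code z; a] ++ graph_code G by [].
have rm : code.2 = c :: [seq cost e | e <- edges G] by [].
have szle := size_input_size code.
clearbody code.
have [] := nth_graph_code G [:: vertex_code s; vertex_code z; a] [::].
rewrite cats0 -nm /=; set n := #|_| => nth3 nthm nthE.
have [nth0 nth1 nth2] : [/\ nth 0%N code.1 0 = vertex_code s,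
  nth 0%N code.1 1 = vertex_code z & nth 0%N code.1 2 = a] by rewrite nm.
have rth0 : nth 0 code.2 0 = c by rewrite rm.
have rthE i : (i < m)%N -> nth 0 code.2 (1 + i)%N = eC s i.
  by move=> ltim; rewrite rm /= (nth_map (TEdge s s 0 0 0)).
have sz : size code.1 = (3 + n + 1 + 1 + 4 * m)%N.
  rewrite nm size_cat /graph_code /= size_cat /= size_edges_code -/m.
  by rewrite size_map -cardE -/n; lia.
move=> {nm rm}.
apply: (@runs_weaken _ (17 + (core_bound m + 3)) _ _ _ Q) => //.
  have le3 : (m.+1 ^ 3 <= input_size code ^ 3)%N by rewrite leq_exp2r //; lia.
  by have := core_bound_le m; lia.
have eb4 : (3 + n + 1 + 1 + 4 * m <= 3 + n + 1 + 1 + (m + m + (m + m)))%N by lia.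
pose envG := env m (vertex_code s) (vertex_code z) (3 + n + 1 + 1) 1
  (3 + n + 1 + 1 + (m + m + (m + m))) (1 + m) a c (eS s) (eD s) (eA s) (eL s)
    (eC s).
apply: (runs_cat (Q1 := fun st => envG st /\ nmem st = nth 0%N code.1)).
  do 17! (apply: runs_do; rewrite /= ?nth0 ?nth1 ?nth2 ?nth3 ?nthm ?rth0).
  apply: runs_nil; split=> //.
  by split=> //= i /(nth_eaddr s nthE)[].
move=> st [ev nm].
apply: (runs_cat (runs_core eb4 (leqnn _) ev _)).
  (* The flags lie beyond the input, where [nth] returns its default 0. *)
  by move=> i ltim; rewrite nm nth_default // sz; lia.
move=> st1 [st0 [ev1 sd cov out _]].
have Qout : s != z -> Q st1.
  move=> nsz; rewrite /Q out.
  have := @table_path _ _ _ _ _ _ _ (fun a' c' =>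
    (a' <= a)%N && (c' <= c)) nsz sd cov.
  case=> [a1 a2 c1 c2 /andP[le_a le_c] le_a' le_c'||].
  - by rewrite (leq_trans le_a') ?(le_trans le_c').
  - by move=> [P pP /andP[aP cP]]; split=> // _; exists P.
  - by move=> noP; split=> // -[P [pP aP cP]]; case: noP; exists P; rewrite ?aP.
apply: runs_if; rewrite /= (envS ev1) (envZ ev1);
  case: leqP => [le1|gt1] /=; last first.
  by apply: runs_nil; apply: Qout; apply: contraTneq gt1 => ->; rewrite ltnn.
apply: runs_if; rewrite /= (envS ev1) (envZ ev1);
  case: leqP => [le2|gt2] /=; last first.
  by apply: runs_nil; apply: Qout; apply: contraTneq gt2 => ->; rewrite ltnn.
apply: runs_do; apply: runs_nil; split=> // -[P [/is_path_neq + _ _]].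
by rewrite -(inj_eq (@vertex_code_inj _ G)) eqn_leq le1 le2.
Qed.

Lemma efficient_decidable :
  polytime_decidable (@efficiency_code R)
    (fun x => efficient (eff_s x) (eff_z x) (eff_path x)).
Proof.
apply: (@polytime_intro _ _ _ _ efficiency_program 300 3) => -[G s z P pP] /=.
set code := efficiency_code _; set m := size (edges G); set k := size P.
set Q := (Q in runs _ _ _ Q).
have nm : code.1 = [:: vertex_code s; vertex_code z] ++ graph_code G ++ k :: edges_code P.
  by [].
have rm : code.2 = [seq cost e | e <- edges G] ++ [seq cost e | e <- P] by [].
have szle := size_input_size code.
clearbody code.
have k_gt0 : (0 < k)%N by rewrite /k; case: (P) pP.
have [] := nth_graph_code G [:: vertex_code s; vertex_code z] (k :: edges_code P).
rewrite -nm /=; set n := #|_| => nth2 nthm nthE.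
have [nth0 nth1] : nth 0%N code.1 0 = vertex_code s /\
  nth 0%N code.1 1 = vertex_code z by rewrite nm.
have rthE i : (i < m)%N -> nth 0 code.2 (0 + i)%N = eC s i.
  by move=> ltim; rewrite rm nth_cat size_map ltim (nth_map (TEdge s s 0 0 0)).
have sz : size code.1 = (2 + n + 1 + 1 + 4 * m + 1 + 4 * k)%N.
  rewrite nm !size_cat /graph_code /= size_cat /= !size_edges_code -/m.
  by rewrite size_map -cardE -/n -/k; lia.
(* A variable with an equation keeps the offset folded during symbolic execution. *)
have [eb ebE] : {eb | eb = (2 + n + 1 + 1)%N} by exists (2 + n + 1 + 1)%N.
rewrite -ebE in nthE sz; set pb := (eb + (m + m + (m + m)))%N.
have nthk : nth 0%N code.1 pb = k.
  rewrite nthE nth_cat size_edges_code ltnNge -/m (_ : 4 * m <= _)%N;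
    last by lia.
  by rewrite (_ : _ - _ = 0)%N //; lia.
set l := nth (TEdge s s 0 0 0) P k.-1.
have [ntha ntht] : nth 0%N code.1 (pb + (k + k + (k + k)) - 1) = avail l /\
    nth 0%N code.1 (pb + (k + k + (k + k))) = trav l.
  have [|_ _ <- <-] := @nth_edges_code _ _ (TEdge s s 0 0 0) P [::] k.-1.
    by rewrite prednK.
  have nthP j : nth 0%N code.1 (pb + 1 + j) = nth 0%N (edges_code P ++ [::]) j.
    rewrite cats0 /pb -!addnA nthE nth_cat size_edges_code ltnNge -/m (_ : 4 * m <= _)%N.
      by rewrite (_ : _ - _ = j.+1)%N //; lia.
    by lia.
  by split; rewrite -nthP; congr nth; lia.
have arrE : arrival P = (avail l + trav l)%N.
  by rewrite /l /k nth_last; case: (P) pP.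
have costE : path_cost P = \sum_(0 <= i < k) nth 0 code.2 (m + i)%N.
  rewrite /path_cost (big_nth (TEdge s s 0 0 0)) big_nat [RHS]big_nat.
  apply: eq_bigr => i /andP[_ ltik].
  by rewrite rm nth_cat size_map -/m ltnNge leq_addr addKn /= (nth_map (TEdge s s 0 0 0)).
move=> {nm rm}.
apply: (@runs_weaken _ (22 + ((k * 5).+1 + (core_bound m + 1))) _ _ _ Q) => //.
  have le3 : ((m + k).+1 ^ 3 <= input_size code ^ 3)%N by rewrite leq_exp2r //; lia.
  (* The cube also absorbs the linear time for summing the [k] costs of [P]. *)
  have le3' : (m.+1 ^ 3 + k <= (m + k).+1 ^ 3)%N by clear; nia.
  by have := core_bound_le m; lia.
have eb4 : (eb + 4 * m <= pb + (k + k + (k + k)) + 1)%N by rewrite /pb; lia.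
pose inv st := [/\ [/\ nreg st rOne = 1%N, nreg st rS = vertex_code s,
   nreg st rZ = vertex_code z, nreg st rM = m & nreg st rE = eb],
  [/\ nreg st rC = 0%N, nreg st rF = (pb + (k + k + (k + k)) + 1)%N,
    nreg st rT = (m + k)%N & nreg st rA = arrival P],
  nreg st rI = k, rreg st xBound = 0 &
  nmem st = nth 0%N code.1 /\ rmem st = nth 0 code.2].
apply: (runs_cat (Q1 := inv)).
  do 22! (apply: runs_do;
    rewrite /= ?nth0 ?nth1 ?nth2 ?nthm -?ebE -?/pb ?nthk ?ntha ?ntht).
  apply: runs_nil; split=> //=; split=> //=.
  by rewrite addnC arrE.
move=> st [[n1 nS nZ nM nE] [nC nF nT nA] nI rB [nm rm]].
apply: runs_cat (runs_sum_costs n1 nI rB) _ => st1 [nst1 nm1 rm1 sum].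
have ev : env m (vertex_code s) (vertex_code z) eb 0
    (pb + (k + k + (k + k)) + 1) (m + k) (arrival P) (path_cost P)
    (eS s) (eD s) (eA s) (eL s) (eC s) st1.
  split; rewrite ?nst1 ?nm1 ?rm1 ?nm ?rm //; first by rewrite sum nM rm costE.
  - by move=> i /(nth_eaddr s nthE)[].
  - by move=> i /(nth_eaddr s nthE)[].
  - by move=> i /(nth_eaddr s nthE)[].
  - by move=> i /(nth_eaddr s nthE)[].
have lemT : (0 + m <= m + k)%N by rewrite add0n leq_addr.
apply: (runs_cat (runs_core eb4 lemT ev _)).
  by move=> i ltim; rewrite nm1 nm nth_default // sz /pb; lia.
move=> st2 [st0 [ev2 sd cov _ strict]].
apply: runs_do; apply: runs_nil; rewrite /Q /= (envOne ev2) strict.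
(* The values that dominate [P]. This set is downward closed, since a strict coordinate stays strict
   when lowered. *)
pose K a' c' := [&& (a' <= arrival P)%N, c' <= path_cost P &
                 (a' < arrival P)%N || (c' < path_cost P)].
have nsz := is_path_neq pP.
rewrite (eq_has (_ : better _ _ _ _ _ _ _ _ _ =1 fun i =>
  [&& flag (pb + (k + k + (k + k)) + 1) st0 i, eD s i == vertex_code z &
      K (eA s i + eL s i)%N (tab (m + k) st0 i)])); last first.
  by move=> i; rewrite /better /good /K -!andbA.
have KQ Q' : K (arrival Q') (path_cost Q') <->
    (path_cost Q' < path_cost P /\ (arrival Q' <= arrival P)%N) \/
    (path_cost Q' <= path_cost P /\ (arrival Q' < arrival P)%N).
  split=> [/and3P[aQ cQ /orP[]]|[[cQ aQ]|[cQ aQ]]]; [by right|by left| |].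
    by rewrite /K aQ (ltW cQ) cQ orbT.
  by rewrite /K aQ (ltnW aQ) cQ.
have := @table_path _ _ _ _ _ _ _ K nsz sd cov.
case=> [a1 a2 c1 c2 /and3P[le_a le_c lt] le_a' le_c'|[Q' pQ' KQ']|noQ].
- rewrite /K (leq_trans le_a') ?(le_trans le_c') //=.
  by case/orP: lt => lt;
    [rewrite (leq_ltn_trans le_a')|rewrite (le_lt_trans le_c') ?orbT].
- by split=> // -[_ []]; exists Q' => //; apply/KQ.
by split=> // _; split=> // -[Q' pQ' /KQ KQ']; case: noQ; exists Q'.
Qed.

End Decide.

Theorem theorem6 (R : realType) :
  polytime_decidable (@efficiency_code R)
    (fun x => efficient (eff_s x) (eff_z x) (eff_path x)) /\
  polytime_decidable (@bounded_path_code R)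
    (fun x => exists P : seq (tedge (vertices (bp_graph x)) R),
       [/\ is_path (bp_s x) (bp_z x) P,
           (arrival P <= bp_arrival x)%N
         & path_cost P <= bp_cost x]).
Proof. by split; [exact: efficient_decidable | exact: bounded_path_decidable]. Qed.
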